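(* Let $S$ be a numerical semigroup. Then the poset $(\mathfrak{I}_0(S),\preceq)$ is a lattice if and only if $\operatorname{m}(S)\le 4$.
   Context: $\mathbb{N}$ denotes the set of non-negative integers. A numerical semigroup is a submonoid $S$ of $(\mathbb{N},+)$ with $\mathbb{N}\setminus S$ finite. The multiplicity $\operatorname{m}(S)$ is the least positive integer belonging to $S$. A (relative) ideal of $S$ is a subset $I\subseteq\mathbb{Z}$ such that $I+S=I$ and $z+I\subseteq S$ for some integer $z$ (equivalently, $I+S=I$ and $\min(I)$ exists). An ideal $I$ is normalized if $\min(I)=0$; $\mathfrak{I}_0(S)$ denotes the (finite) set of normalized ideals of $S$. For ideals $I,J$, $I+J=\{i+j : i\in I, j\in J\}$. For $I,J\in\mathfrak{I}_0(S)$, write $I\preceq J$ if there exists $K\in\mathfrak{I}_0(S)$ with $I+K=J$; this is a partial order on $\mathfrak{I}_0(S)$. A poset is a lattice if every pair of its elements has an infimum and a supremum. *)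

(* Defs.v *)
From HB Require Import structures.
From mathcomp Require Import all_boot all_order all_algebra.
From mathcomp Require Import boolp classical_sets cardinality.

Set Implicit Arguments.
Unset Strict Implicit.
Unset Printing Implicit Defensive.

Import Order.TTheory GRing.Theory Num.Theory.
Local Open Scope classical_set_scope.
Local Open Scope ring_scope.

Record numSemigroup := NumSemigroup {
  numsg_set :> set nat;
  numsg0 : numsg_set 0%N;
  numsgD : forall s t : nat, numsg_set s -> numsg_set t -> numsg_set (s + t)%N;
  numsg_cofinite : finite_set (~` numsg_set) }.

Lemma numsg_pos (S : numSemigroup) :
  exists n : nat, `[< (S : set nat) n >] && (0 < n)%N.
Proof.
apply: contrapT => noS; apply: infinite_nat.
have : finite_set (~` S `|` [set 0%N]).
  by rewrite finite_setU; split; [exact: numsg_cofinite|exact: finite_set1].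
apply: sub_finite_set => -[|n] _; first by right.
by left=> Sn; apply: noS; exists n.+1; rewrite andbT; apply/asboolP.
Qed.

Definition multiplicity (S : numSemigroup) : nat := ex_minn (numsg_pos S).

Definition sumset (A B : set int) : set int := [set a + b | a in A & b in B].

Definition numsgZ (S : numSemigroup) : set int := [set s%:Z | s in S].

(* Nonemptiness is what makes the existence of z equivalent to that of min I. *)
Definition is_ideal (S : numSemigroup) (I : set int) : Prop :=
  [/\ I !=set0, sumset I (numsgZ S) = I &
      exists z : int, [set z + i | i in I] `<=` numsgZ S].

Definition is_normalized (I : set int) : Prop := I 0 /\ lbound I 0.

Record nideal (S : numSemigroup) := NIdeal {
  nideal_set :> set int;
  nideal_ideal : is_ideal S nideal_set;
  nideal_normalized : is_normalized nideal_set }.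

HB.instance Definition _ (S : numSemigroup) := gen_eqMixin (nideal S).
HB.instance Definition _ (S : numSemigroup) := gen_choiceMixin (nideal S).

Definition nideal_le (S : numSemigroup) (I J : nideal S) : bool :=
  `[< exists K : nideal S, sumset I K = J >].

Lemma nideal_inj (S : numSemigroup) (I J : nideal S) :
  nideal_set I = nideal_set J -> I = J.
Proof.
case: I J => I i1 i2 [J j1 j2] /= IJ; case: _ / IJ j1 j2 => j1 j2.
by rewrite (Prop_irrelevance i1 j1) (Prop_irrelevance i2 j2).
Qed.

Lemma sumsetA (A B C : set int) :
  sumset A (sumset B C) = sumset (sumset A B) C.
Proof.
apply/seteqP; split=> x.
  case=> a Aa [_ [b Bb [c Cc <-]] <-].
  by exists (a + b); [exists a => //; exists b|exists c => //; rewrite addrA].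
case=> _ [a Aa [b Bb <-]] [c Cc <-].
by exists a => //; exists (b + c); [exists b => //; exists c|rewrite addrA].
Qed.

Lemma sumset_numsgZ (S : numSemigroup) :
  sumset (numsgZ S) (numsgZ S) = numsgZ S.
Proof.
apply/seteqP; split=> x.
  case=> _ [s Ss <-] [_ [t St <-] <-].
  by exists (s + t)%N; [exact: numsgD|rewrite PoszD].
move=> Sx; exists x => //.
by exists 0; [exists 0%N; [exact: numsg0|]|rewrite addr0].
Qed.

Lemma numsgZ_ideal (S : numSemigroup) : is_ideal S (numsgZ S).
Proof.
split; [by exists 0; exists 0%N; [exact: numsg0|]|exact: sumset_numsgZ|].
by exists 0 => _ [x Sx <-]; rewrite add0r.
Qed.

Lemma numsgZ_normalized (S : numSemigroup) : is_normalized (numsgZ S).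
Proof. by split=> [|_ [s _ <-] //]; exists 0%N; [exact: numsg0|]. Qed.

Lemma sumset_ideal (S : numSemigroup) (I J : set int) :
  is_ideal S I -> is_ideal S J -> is_ideal S (sumset I J).
Proof.
case=> -[i Ii] IS [y yI] [[j Jj] JS [z zJ]]; split.
- by exists (i + j); exists i => //; exists j.
- by rewrite -sumsetA JS.
- exists (y + z) => _ [_ [a Ia [b Jb <-]] <-].
  rewrite -sumset_numsgZ; exists (y + a); first by apply: yI; exists a.
  by exists (z + b); [apply: zJ; exists b|rewrite addrACA].
Qed.

Lemma sumset_normalized (I J : set int) :
  is_normalized I -> is_normalized J -> is_normalized (sumset I J).
Proof.
move=> [I0 Ige] [J0 Jge]; split.
  by exists 0 => //; exists 0 => //; rewrite addr0.
by move=> _ [a Ia [b Jb <-]]; exact: addr_ge0 (Ige _ Ia) (Jge _ Jb).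
Qed.

Lemma nideal_le_sub (S : numSemigroup) (I J : nideal S) :
  nideal_le I J -> I `<=` J.
Proof.
move=> /asboolP[K <-] x Ix; exists x => //; exists 0; last by rewrite addr0.
by case: (nideal_normalized K).
Qed.

Lemma nideal_le_refl (S : numSemigroup) : reflexive (@nideal_le S).
Proof.
move=> I; apply/asboolP.
exists (NIdeal (numsgZ_ideal S) (numsgZ_normalized S)).
by case: (nideal_ideal I).
Qed.

Lemma nideal_le_anti (S : numSemigroup) : antisymmetric (@nideal_le S).
Proof.
move=> I J /andP[IJ JI]; apply: nideal_inj.
by apply/seteqP; split; exact: nideal_le_sub.
Qed.

Lemma nideal_le_trans (S : numSemigroup) : transitive (@nideal_le S).
Proof.
move=> J I L /asboolP[K IKJ] /asboolP[M JML]; apply/asboolP.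
exists (NIdeal (sumset_ideal (nideal_ideal K) (nideal_ideal M))
  (sumset_normalized (nideal_normalized K) (nideal_normalized M))).
by rewrite /= sumsetA IKJ.
Qed.

Fact nideal_display : Order.disp_t. Proof. exact: Order.Disp tt tt. Qed.

HB.instance Definition _ (S : numSemigroup) :=
  Order.Le_isPOrder.Build nideal_display (nideal S)
    (@nideal_le_refl S) (@nideal_le_anti S) (@nideal_le_trans S).

Definition is_lattice (d : Order.disp_t) (T : porderType d) : Prop :=
  forall x y : T,
    infimums [set x; y] !=set0 /\ supremums [set x; y] !=set0.

(* Main.v *)
Require Import Defs.
From mathcomp Require Import all_boot all_order all_algebra.
From mathcomp Require Import boolp classical_sets cardinality.
From mathcomp Require Import zify.

Set Implicit Arguments.
Unset Strict Implicit.
Unset Printing Implicit Defensive.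

Import Order.TTheory GRing.Theory Num.Theory.
Local Open Scope classical_set_scope.
Local Open Scope ring_scope.

(** For normalized ideals, I precedes J exactly when J is a union of translates
    t + I contained in J (lemma [nideal_leP]): the best candidate for K is the
    residual {t | t + I is contained in J}.  Call this relation covering.  It
    makes sense for all sets of non-negative integers that contain 0 and are
    closed under adding m, where m is any nonzero element of S, and S disappears
    from the combinatorics.

    Multiplicity m at least 5.  An ideal that contains all integers from m on
    is given by its part below m.  Let A, B, C, D be those with parts {0, 1},
    [0, m - 4] and m - 2, [0, m - 2], and [0, m - 1] without m - 3.  Both A and
    B precede C and D.  Since the order refines inclusion, a supremum of A and B
    would contain B and be contained in the intersection of C and D, which is B.
    But A does not precede B: the element m - 2 would need the translate of A at
    m - 2, which contains m - 1, or the one at m - 3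
    (lemma [lattice_multiplicity]).

    Multiplicity at most 4.  Then 3 or 4 belongs to S, so that m = 3 or m = 4
    can be used.  The point of such a small m is that, if x, z and x + z lie in
    C and the residues of 0, x, z and x + z fill Z/m, then every integer above
    x + z lies in C (lemma [absorb]).  Hence, if A covers C, an element y of C
    outside A has y + A contained in C, save for one exceptional configuration
    with m = 4 and y = 2 mod 4 (lemma [covers_split]).  This rigidity gives two facts
    on sets A, B covering C: their union covers C ([covers_setU]); and if A is
    contained in B but does not cover it, then adding to B one translate t + A,
    chosen independently of C, gives a strictly larger set that still covers C
    ([covers_enlarge]).

    Take now, among the common lower bounds of two ideals, one that is maximal
    for inclusion, say M.  By the first fact M contains every other common lower
    bound K, and by the second fact K covers M, for otherwise M could be
    enlarged.  So M is the infimum ([meets_small]).  As the poset has a greatest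
    element and chains of ideals have bounded length, suprema follow from infima
    ([lattice_of_meets]). *)

(** * Covering a set by translates of another *)

Definition fits (A C : set int) (t : int) : Prop := forall a, A a -> C (t + a).

Definition covered (A C : set int) (y : int) : Prop :=
  exists2 t, fits A C t & A (y - t).

Definition covers (A C : set int) : Prop := forall y, C y -> covered A C y.

(** The properties of a normalized ideal that remain when, of the semigroup,
    only one element m is retained. *)
Definition periodic (m : int) (A : set int) : Prop :=
  [/\ A 0, lbound A 0 & forall x, A x -> A (x + m)].

Definition shift (t : int) (A : set int) : set int := [set t + a | a in A].

Lemma fits_setU_shift A B C t x :
  fits B C t -> fits A C (t + x) -> fits (B `|` shift x A) C t.
Proof.
by move=> tBC txAC e [/tBC //|[a Aa <-]]; rewrite addrA; exact: txAC.
Qed.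

Section Periodic.
Context (m : int).
Implicit Types A B C : set int.

Lemma periodic0 A : periodic m A -> A 0. Proof. by case. Qed.

Lemma periodic_ge0 A x : periodic m A -> A x -> 0 <= x.
Proof. by case=> _ A0 _ /A0. Qed.

Lemma fits_mem A C t : periodic m A -> fits A C t -> C t.
Proof. by move=> [A0 _ _] tAC; rewrite -[t]addr0; exact: tAC. Qed.

(** The translate that covers 0 can only start at 0. *)
Lemma covers_sub A C : periodic m A -> periodic m C -> covers A C -> A `<=` C.
Proof.
move=> hA hC AC.
have [t tAC /(periodic_ge0 hA)] := AC 0 (periodic0 hC).
have := periodic_ge0 hC (fits_mem hA tAC); rewrite sub0r => t0 t0'.
have t00 : t = 0 by lia.
by move=> a /tAC; rewrite t00 add0r.
Qed.

Context (m_gt0 : 0 < m).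

Lemma periodic_up A x y :
  periodic m A -> A x -> x <= y -> (m %| y - x)%Z -> A y.
Proof.
move=> [_ _ Am] Ax xy /dvdzP[q yx].
have q0 : 0 <= q by nia.
have -> : y = x + `|q|%N%:Z * m by rewrite gez0_abs// -yx addrC subrK.
elim: `|q|%N => [|n IHn]; first by rewrite mul0r addr0.
by rewrite intS mulrDl mul1r addrCA addrC; exact: Am.
Qed.

Lemma fits_up A C t u :
  periodic m C -> fits A C t -> t <= u -> (m %| u - t)%Z -> fits A C u.
Proof.
move=> hC tAC tu mut a /tAC Cta.
apply: (periodic_up hC Cta); first by rewrite lerD2r.
by have -> : u + a - (t + a) = u - t by lia.
Qed.

(** Induction along the residue classes modulo m, each of which starts at its
    first element in C. *)
Lemma first_ind C (P : int -> Prop) : periodic m C ->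
    (forall y, C y -> ~ C (y - m) -> P y) ->
    (forall y, C (y - m) -> P (y - m) -> P y) ->
  forall y, C y -> P y.
Proof.
move=> hC Pfirst Pstep y; move: {2}`|y|%N (leqnn `|y|%N) => n.
elim: n y => [|n IHn] y yn Cy; have y0 := periodic_ge0 hC Cy.
  by apply: Pfirst => // /(periodic_ge0 hC); lia.
have [Cym|] := pselect (C (y - m)); last exact: Pfirst.
have ym0 := periodic_ge0 hC Cym.
by apply: Pstep => //; apply: IHn => //; lia.
Qed.

(** A covering of y by t + A becomes one of y + m by t + m + A; only the first
    element of each residue class matters. *)
Lemma covers_first A C : periodic m C ->
  (forall y, C y -> ~ C (y - m) -> covered A C y) -> covers A C.
Proof.
move=> hC Cfirst; apply: (first_ind hC) => // y _ [t tAC Aymt].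
exists (t + m); last by have -> : y - (t + m) = y - m - t by lia.
by apply: (fits_up hC tAC); [lia|rewrite addrC addKr].
Qed.

Lemma exists_first A a : periodic m A -> A a ->
  exists a0, [/\ A a0, ~ A (a0 - m), a0 <= a & (m %| a - a0)%Z].
Proof.
move=> hA; move: a.
apply: (@first_ind A (fun a => exists a0, _)) => // a; last first.
  move=> _ [a0 [Aa0 nAa0 a0a ma0]]; exists a0; split=> //; first lia.
  have -> : a - a0 = (a - m - a0) + m by lia.
  by rewrite rpredD // dvdzz.
by move=> Aa nAa; exists a; split=> //; rewrite subrr dvdz0.
Qed.

Lemma fits_dvd A C t :
  periodic m C -> A `<=` C -> 0 <= t -> (m %| t)%Z -> fits A C t.
Proof.
move=> hC AC t0 mt; apply: (@fits_up A C 0) => //; last by rewrite subr0.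
by move=> a /AC; rewrite add0r.
Qed.

Lemma first_le C y z : periodic m C -> ~ C (y - m) -> C z -> (m %| y - z)%Z ->
  y <= z.
Proof.
move=> hC nCym Cz myz; rewrite leNgt; apply/negP => zy; apply: nCym.
case/dvdzP: myz => q yz.
have q0 : 0 < q by nia.
apply: (periodic_up hC Cz); first nia.
by apply/dvdzP; exists (q - 1); rewrite mulrBl mul1r -yz; lia.
Qed.

(** According to the four alternatives, x + z + n is congruent to x + z, z, x
    or 0, and lies above it.  When the residues of 0, x, z and x + z fill Z/m,
    one of the alternatives always holds and C contains all integers above
    x + z.  For m = 3 or m = 4 this fails only in a few degenerate cases. *)
Lemma absorb C x z n : periodic m C -> C x -> C z -> C (x + z) -> 0 <= n ->
    [|| (m %| n)%Z, (m %| x + n)%Z, (m %| z + n)%Z | (m %| x + z + n)%Z] ->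
  C (x + z + n).
Proof.
move=> hC Cx Cz Cxz n0; have x0 := periodic_ge0 hC Cx.
have z0 := periodic_ge0 hC Cz.
have C0 := periodic0 hC.
case/or4P => mn.
- apply: (periodic_up hC Cxz); first by rewrite lerDl.
  by rewrite addrC addKr.
- apply: (periodic_up hC Cz); first lia.
  by have -> : x + z + n - z = x + n by lia.
- apply: (periodic_up hC Cx); first lia.
  by have -> : x + z + n - x = z + n by lia.
- by apply: (periodic_up hC C0); [lia|rewrite subr0].
Qed.

End Periodic.

(** * Periods three and four *)

Section SmallPeriod.
Context (m : int) (m34 : m = 3 \/ m = 4).
Implicit Types A B C : set int.

Let m0 : 0 < m. Proof. by case: m34 => ->. Qed.

(** Write y = t + a with t + A contained in C.  As y is not in A, neither y nor
    t is 0 modulo m.  If a is 0 modulo m, then y + A sits above t + A; otherwise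
    [absorb] puts all integers above y in C, unless m = 4 and t, a have
    the same odd residue. *)
Lemma covers_split A C y : periodic m A -> periodic m C ->
    covers A C -> C y -> ~ A y ->
  fits A C y \/ [/\ m = 4, (y %% 4)%Z = 2 & exists z a,
    [/\ y = z + a, A a, fits A C z, (z %% 4 = a %% 4)%Z & (z %% 2)%Z = 1]].
Proof.
move=> hA hC AC Cy nAy.
have [t tAC Ayt] := AC y Cy; have Ct := fits_mem hA tAC.
have Ca := covers_sub hA hC AC Ayt.
have t0 := periodic_ge0 hC Ct; have yt0 := periodic_ge0 hA Ayt.
have nmy : ~ (m %| y)%Z.
  move=> my; apply: nAy; apply: (periodic_up m0 hA (periodic0 hA)); first lia.
  by rewrite subr0.
have nmt : ~ (m %| t)%Z.
  move=> mt; apply: nAy; apply: (periodic_up m0 hA Ayt); first lia.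
  by have -> : y - (y - t) = t by lia.
have [mty|nmty] := boolP (m %| y - t)%Z.
  by left; apply: (fits_up m0 hC tAC); [lia|].
have [[m4 tyt]|ny2] := pselect (m = 4 /\ (t %% 4 = (y - t) %% 4)%Z).
  right; move: nmy nmt nmty; rewrite m4 => nmy nmt nmty.
  by split=> //; [lia|exists t, (y - t); split=> //; lia].
left=> a Aa; have -> : y + a = t + (y - t) + a by lia.
apply: (absorb m0 hC) => //; first by rewrite addrC subrK.
  exact: periodic_ge0 hA Aa.
by move: nmy nmt nmty ny2; case: m34 => ->; lia.
Qed.

Lemma covers_split_odd A C y : periodic m A -> periodic m C ->
    covers A C -> C y -> (m = 4 -> (y %% 4)%Z <> 2) -> ~ A y -> fits A C y.
Proof.
move=> hA hC AC Cy y2 nAy.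
by have [|[m4 /(y2 m4)]] := covers_split hA hC AC Cy nAy.
Qed.

(** The mixed case of [covers_setU]: for A the translate at y itself is
    available, for B only the exceptional one at w.  If y + B leaves C at
    y + b', then b' = w mod 4, since [absorb] deals with the other residues;
    from this it follows that w + A is contained in C too. *)
Lemma covered_setU_mixed A B C y w b :
    periodic m A -> periodic m B -> periodic m C ->
    covers A C -> covers B C -> m = 4 -> fits A C y ->
    y = w + b -> B b -> fits B C w ->
    (w %% 4 = b %% 4)%Z -> (w %% 2)%Z = 1 ->
  covered (A `|` B) C y.
Proof.
move=> hA hB hC AC BC m4 yAC yE Bb wBC wb w1.
have Cw := fits_mem hB wBC; have Cy := fits_mem hA yAC.
have BsC := covers_sub hB hC BC.
have b0 := periodic_ge0 hB Bb.
have [yBC|/existsNP[b' /not_implyP[Bb' nCyb']]] := pselect (fits B C y).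
  by exists y; [move=> e [/yAC|/yBC]|left; rewrite subrr; exact: periodic0 hA].
have b'0 := periodic_ge0 hB Bb'.
have b'w : (b' %% 4 = w %% 4)%Z.
  apply: contrapT => b'w; apply: nCyb'; rewrite yE.
  by apply: (absorb m0 hC) => //; [exact: BsC|rewrite -yE|rewrite m4; lia].
suff wAC : fits A C w.
  by exists w; [move=> e [/wAC|/wBC]|right; have -> : y - w = b by lia].
(* When w is in A, then y + w is in C but y + b' is not, so b' lies below w. *)
have [Aw|] := pselect (A w); last by apply: covers_split_odd => //; lia.
have b'_lt : b' < w.
  rewrite ltNge; apply/negP => wb'; apply: nCyb'.
  by apply: (periodic_up m0 hC (yAC _ Aw)); [lia|rewrite m4; lia].
suff b'AC : fits A C b'.
  by apply: (fits_up m0 hC b'AC); [lia|rewrite m4; lia].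
apply: covers_split_odd => //; [exact: BsC|lia|].
by move=> /yAC.
Qed.

(** A translate that serves both A and B is found at y when [covers_split] puts
    y + A and y + B in C.  If both sets are in the exceptional case with the
    same residue, the larger of the two translations serves both; with opposite
    odd residues, C contains all integers above y. *)
Lemma covers_setU A B C : periodic m A -> periodic m B -> periodic m C ->
  covers A C -> covers B C -> covers (A `|` B) C.
Proof.
move=> hA hB hC AC BC y Cy.
have AsC := covers_sub hA hC AC; have BsC := covers_sub hB hC BC.
have [ABy|/not_orP[nAy nBy]] := pselect ((A `|` B) y).
  by exists 0; [move=> e; rewrite add0r => -[/AsC|/BsC]|rewrite subr0].
have [yAC|[m4 y2 [z [a [yza Aa zAC za z1]]]]] := covers_split hA hC AC Cy nAy.
  have [yBC|[m4 y2 [w [b [ywb Bb wBC wb w1]]]]] :=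
    covers_split hB hC BC Cy nBy.
    exists y; first by move=> e [/yAC|/yBC].
    by left; rewrite subrr; exact: periodic0 hA.
  exact: covered_setU_mixed ywb Bb wBC wb w1.
have [yBC|[_ _ [w [b [ywb Bb wBC wb w1]]]]] := covers_split hB hC BC Cy nBy.
  by rewrite setUC; exact: covered_setU_mixed yza Aa zAC za z1.
have Cz := fits_mem hA zAC; have Cw := fits_mem hB wBC.
have a0 := periodic_ge0 hA Aa; have b0 := periodic_ge0 hB Bb.
have z0 := periodic_ge0 hC Cz; have w0 := periodic_ge0 hC Cw.
have [zw|zw] := pselect ((z %% 4 = w %% 4)%Z).
  have [wz|/ltW zw'] := leP w z.
    have zBC : fits B C z by apply: (fits_up m0 hC wBC); rewrite ?m4; lia.
    exists z; first by move=> e [/zAC|/zBC].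
    by left; have -> : y - z = a by lia.
  have wAC : fits A C w by apply: (fits_up m0 hC zAC); rewrite ?m4; lia.
  exists w; first by move=> e [/wAC|/wBC].
  by right; have -> : y - w = b by lia.
have full n : 0 <= n -> C (y + n).
  move=> n0; have [n4|[n4|[n4|n4]]] : ((y + n) %% 4 = z %% 4)%Z \/
     ((y + n) %% 4 = w %% 4)%Z \/ ((y + n) %% 4 = y %% 4)%Z \/
     ((y + n) %% 4 = 0)%Z.
  - lia.
  - by apply: (periodic_up m0 hC Cz); rewrite ?m4; lia.
  - by apply: (periodic_up m0 hC Cw); rewrite ?m4; lia.
  - by apply: (periodic_up m0 hC Cy); rewrite ?m4; lia.
  - by apply: (periodic_up m0 hC (periodic0 hC)); rewrite ?m4; lia.
exists y; last by left; rewrite subrr; exact: periodic0 hA.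
move=> e ABe; apply: full.
by case: ABe; [exact: periodic_ge0 hA|exact: periodic_ge0 hB].
Qed.

(** Enlarging B by the translate of A at an element x of B.  For y in C outside
    B, the candidates for a translate of the enlarged set are y, when y + B is
    contained in C, and otherwise the exceptional w provided by [covers_split]
    for B.  In both cases what remains is to put y + x + A, or w + x + A, in C.
    If y + x, or w + x, is 0 modulo m, it suffices that C contains A; otherwise
    [absorb] applies unless the two summands have the same odd residue modulo 4,
    and then the minimality of x and y in their residue classes is used. *)
Lemma covers_setU_shift A B C x : periodic m A -> periodic m B ->
    periodic m C -> A `<=` B -> covers A C -> covers B C ->
    B x -> ~ B (x - m) -> ~ A x -> fits A C x ->
  covers (B `|` shift x A) C.
Proof.
move=> hA hB hC AB AC BC Bx nBxm nAx xAC.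
have AsC := covers_sub hA hC AC; have BsC := covers_sub hB hC BC.
have x0 := periodic_ge0 hB Bx.
have nmx : ~ (m %| x)%Z.
  move=> mx; apply: nAx; apply: (periodic_up m0 hA (periodic0 hA)) => //.
  by rewrite subr0.
have EsC : fits (B `|` shift x A) C 0.
  by apply: fits_setU_shift; [move=> b /BsC|]; rewrite add0r.
apply: (covers_first m0 hC) => y Cy nCym; have y0 := periodic_ge0 hC Cy.
have [By|nBy] := pselect (B y); first by exists 0; rewrite ?subr0 //; left.
have nAy : ~ A y by move=> /AB.
have nmy : ~ (m %| y)%Z.
  move=> my; apply: nBy; apply: (periodic_up m0 hB (periodic0 hB)) => //.
  by rewrite subr0.
have [yBC|nyBC] := pselect (fits B C y).
  suff yxAC : fits A C (y + x).
    exists y; last by left; rewrite subrr; exact: periodic0 hB.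
    exact: fits_setU_shift.
  have Cyx := yBC _ Bx.
  have [myx|nmyx] := boolP (m %| y + x)%Z.
    by apply: (fits_dvd m0 hC AsC) => //; lia.
  have absorbed a' : A a' -> ~ C (y + x + a') ->
      m = 4 /\ (y %% 4 = x %% 4)%Z /\ (a' %% 4 = x %% 4)%Z.
    move=> Aa' nC; have a'0 := periodic_ge0 hA Aa'.
    apply: contrapT => ncl; apply: nC; apply: (absorb m0 hC) => //.
      exact: BsC.
    by move: nmx nmy nmyx ncl; case: m34 => ->; lia.
  apply: contrapT => /existsNP[a' /not_implyP[Aa' nC]].
  have [m4 [yx a'x]] := absorbed _ Aa' nC.
  have a'0 := periodic_ge0 hA Aa'.
  have yAC : fits A C y.
    by apply: covers_split_odd => // _; move: nmyx; rewrite m4; lia.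
  (* Here m = 4 and x, y, a' have the same odd residue; y + x has residue 2. *)
  have [Ayx|nAyx] := pselect (A (y + x)).
    have [ya'|a'y] := leP y a'.
      by apply: nC; apply: (periodic_up m0 hC (yAC _ Ayx)); rewrite ?m4; lia.
    by apply: nAy; apply: (periodic_up m0 hA Aa'); rewrite ?m4; lia.
  have [/(_ _ Aa') //|[_ _ [z [a [yxza Aa zAC za z1]]]]] :=
    covers_split hA hC AC Cyx nAyx.
  have Cz := fits_mem hA zAC.
  have a0 := periodic_ge0 hA Aa.
  have [zy|zy] := pselect ((z %% 4 = y %% 4)%Z).
    have xa : x < a.
      rewrite ltNge; apply/negP => ax; apply: nAx.
      by apply: (periodic_up m0 hA Aa); rewrite ?m4; lia.
    by have := first_le m0 hC nCym Cz; rewrite m4; lia.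
  by apply: nC; apply: (periodic_up m0 hC Cz); move: nmyx; rewrite ?m4; lia.
have [//|[m4 y2 [w [b [ywb Bb wBC wb w1]]]]] := covers_split hB hC BC Cy nBy.
have Cw := fits_mem hB wBC; have b0 := periodic_ge0 hB Bb.
(* The alternative y in x + A occurs when x is itself the exceptional
   translation for A. *)
suff [yxA|wxAC] : shift x A y \/ fits A C (w + x).
- by exists 0; rewrite ?subr0 //; right.
- exists w; last by left; have -> : y - w = b by lia.
  exact: fits_setU_shift.
have Cwx := wBC _ Bx; have w0 := periodic_ge0 hC Cw.
have [mwx|nmwx] := boolP (m %| w + x)%Z.
  by right; apply: (fits_dvd m0 hC AsC) => //; lia.
have [wx|nwx] := pselect ((w %% 4 = x %% 4)%Z); last first.
  right=> a Aa; apply: (absorb m0 hC) => //; first exact: BsC.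
    exact: periodic_ge0 hA Aa.
  by move: nmx nmwx; rewrite m4; lia.
have [yAC|[_ _ [z [a [yza Aa zAC za z1]]]]] := covers_split hA hC AC Cy nAy.
  right; apply: (fits_up m0 hC yAC); last by rewrite m4; lia.
  by apply: (first_le m0 hC nCym Cwx); rewrite m4; lia.
have Cz := fits_mem hA zAC; have a0 := periodic_ge0 hA Aa.
have zw : (z %% 4 = w %% 4)%Z.
  apply: contrapT => zw; apply: nyBC => b' Bb'; have b'0 := periodic_ge0 hB Bb'.
  have [b'z|b'z] := pselect (((y + b') %% 4 = z %% 4)%Z).
    by apply: (periodic_up m0 hC Cz); rewrite ?m4; lia.
  rewrite ywb; apply: (absorb m0 hC) => //; first exact: BsC.
    by rewrite -ywb.
  by rewrite m4; lia.
(* Now y = z + a = w + b, and x, z, w, a, b all have the same odd residue. *)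
have zx : z <= x.
  by have := first_le m0 hC nCym (xAC _ Aa); rewrite m4; lia.
have [Bz|nBz] := pselect (B z).
  have xz : x <= z by apply: (first_le m0 hB nBxm Bz); rewrite m4; lia.
  by left; exists a => //; lia.
have zBC : fits B C z by apply: covers_split_odd => //; lia.
have yzx : y <= z + x.
  by apply: (first_le m0 hC nCym (zBC _ Bx)); rewrite m4; lia.
by case: nAx; apply: (periodic_up m0 hA Aa); rewrite ?m4; lia.
Qed.

(** For x = 2 mod 4 the translate of A at x need not fit in C.  When x - a is in
    B for some odd a in A, the translate at x - a, which also contains x, does
    fit; taking a minimal in its class makes this translation the largest. *)
Lemma fits_difference A B C x a : m = 4 -> periodic m A -> periodic m B ->
    periodic m C -> A `<=` B -> covers A C -> covers B C ->
    B x -> ~ A x -> (x %% 4)%Z = 2 ->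
    A a -> ~ A (a - m) -> (a %% 2)%Z = 1 -> B (x - a) ->
  fits A C (x - a).
Proof.
move=> m4 hA hB hC AB AC BC Bx nAx x2 Aa nAam a1 Bz a' Aa'.
have AsC := covers_sub hA hC AC; have BsC := covers_sub hB hC BC.
have a0 := periodic_ge0 hA Aa; have z0 := periodic_ge0 hB Bz.
have a'0 := periodic_ge0 hA Aa'.
have [a'4|nza'] := pselect ((m %| a')%Z \/ (m %| x - a + a')%Z).
  have [C0 Cz] := (periodic0 hC, BsC _ Bz).
  case: a'4 => ma'; last by apply: (periodic_up m0 hC C0); rewrite ?subr0; lia.
  by apply: (periodic_up m0 hC Cz); move: ma'; rewrite ?m4; lia.
have [a'a|na'a] := pselect ((a' %% 4 = a %% 4)%Z).
  have aa' : a <= a' by apply: (first_le m0 hA nAam Aa'); rewrite m4; lia.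
  by apply: (periodic_up m0 hC (BsC _ Bx)); rewrite ?m4; lia.
have a'2 : (a' %% 4)%Z = 2 by move: nza'; rewrite m4; lia.
have xa' : x < a'.
  rewrite ltNge; apply/negP => a'x; apply: nAx.
  by apply: (periodic_up m0 hA Aa'); rewrite ?m4; lia.
have [Az|nAz] := pselect (A (x - a)); last first.
  by apply: (covers_split_odd hA hC AC (BsC _ Bz)) => //; lia.
have [xAC|[_ _ [t [b [xtb Ab tAC tb t1]]]]] :=
  covers_split hA hC AC (BsC _ Bx) nAx.
  by apply: (periodic_up m0 hC (xAC _ Az)); rewrite ?m4; lia.
have b0 := periodic_ge0 hA Ab; have Ct := fits_mem hA tAC.
have [ba|ba] := pselect ((b %% 4 = a %% 4)%Z).
  have ab : a <= b by apply: (first_le m0 hA nAam Ab); rewrite m4; lia.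
  by apply: (fits_up m0 hC tAC) => //; rewrite ?m4; lia.
by apply: (periodic_up m0 hC Ct); rewrite ?m4; lia.
Qed.

(** The analogue of [covers_setU_shift] for the translation x - a: for every
    translate w + B in C with w nonzero modulo 4, w + (x - a) + A is in C.  When
    w and x - a have the same odd residue, x in B takes care of the elements of
    A in the class of a, which are at least a. *)
Lemma covers_setU_shift_difference A B C x a : m = 4 -> periodic m A ->
    periodic m B -> periodic m C -> A `<=` B -> covers A C -> covers B C ->
    B x -> ~ A x -> (x %% 4)%Z = 2 ->
    A a -> ~ A (a - m) -> (a %% 2)%Z = 1 -> B (x - a) ->
  covers (B `|` shift (x - a) A) C.
Proof.
move=> m4 hA hB hC AB AC BC Bx nAx x2 Aa nAam a1 Bz.
have zAC := fits_difference m4 hA hB hC AB AC BC Bx nAx x2 Aa nAam a1 Bz.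
have AsC := covers_sub hA hC AC; have BsC := covers_sub hB hC BC.
have a0 := periodic_ge0 hA Aa; have z0 := periodic_ge0 hB Bz.
have shifted w : fits B C w -> ~ (m %| w)%Z -> fits A C (w + (x - a)).
  move=> wBC nmw a' Aa'; have Cw := fits_mem hB wBC.
  have w0 := periodic_ge0 hC Cw; have a'0 := periodic_ge0 hA Aa'.
  have [mwz|nmwz] := boolP (m %| w + (x - a))%Z.
    by apply: (fits_dvd m0 hC AsC) => //; lia.
  have [[wz a'a]|nwa] :=
    pselect ((w %% 4 = (x - a) %% 4)%Z /\ (a' %% 4 = a %% 4)%Z).
    have aa' : a <= a' by apply: (first_le m0 hA nAam Aa'); rewrite m4; lia.
    by apply: (periodic_up m0 hC (wBC _ Bx)); rewrite ?m4; lia.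
  apply: (absorb m0 hC) => //; [exact: BsC|exact: wBC|].
  by move: nmw nmwz nwa; rewrite m4; lia.
move=> y Cy; have y0 := periodic_ge0 hC Cy.
have [By|nBy] := pselect (B y).
  exists 0; last by rewrite subr0; left.
  by apply: fits_setU_shift; [move=> b /BsC|]; rewrite add0r.
have nmy : ~ (m %| y)%Z.
  move=> my; apply: nBy; apply: (periodic_up m0 hB (periodic0 hB)) => //.
  by rewrite subr0.
have [yBC|[_ y2 [w [b [ywb Bb wBC wb w1]]]]] := covers_split hB hC BC Cy nBy.
  exists y; last by left; rewrite subrr; exact: periodic0 hB.
  by apply: fits_setU_shift => //; exact: shifted.
exists w; last by left; have -> : y - w = b by lia.
by apply: fits_setU_shift => //; apply: shifted => //; rewrite m4; lia.
Qed.

(** If no odd difference x - a is in B, the exceptional case of [covers_split]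
    would give z = x - a in C outside B, hence z + B contained in C and z + x in
    C.  An element a' of A for which x + a' is not in C would then be congruent
    to z and smaller, which puts z in A, hence in B. *)
Lemma fits_no_difference A B C x : m = 4 -> periodic m A -> periodic m B ->
    periodic m C -> A `<=` B -> covers A C -> covers B C -> B x -> ~ A x ->
    (forall a, A a -> (a %% 2)%Z = 1 -> ~ B (x - a)) ->
  fits A C x.
Proof.
move=> m4 hA hB hC AB AC BC Bx nAx nBxA.
have BsC := covers_sub hB hC BC.
have [//|[_ x2 [z [a [xza Aa zAC za z1]]]]] :=
  covers_split hA hC AC (BsC _ Bx) nAx.
have Cz := fits_mem hA zAC; have z0 := periodic_ge0 hC Cz.
have nBz : ~ B z by have -> : z = x - a by [lia]; apply: nBxA => //; lia.
have zBC : fits B C z by apply: covers_split_odd => //; lia.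
move=> a' Aa'; have a'0 := periodic_ge0 hA Aa'.
have [a'a|na'a] := pselect ((a' %% 4 = a %% 4)%Z); last first.
  rewrite xza; apply: (absorb m0 hC) => //; last by rewrite m4; lia.
    exact/BsC/AB.
  by rewrite -xza; exact: BsC.
have [za'|a'z] := leP z a'.
  by apply: (periodic_up m0 hC (zBC _ Bx)); rewrite ?m4; lia.
by case: nBz; apply/AB/(periodic_up m0 hA Aa'); rewrite ?m4; lia.
Qed.

(** Take x in B minimal in its residue class and not covered by A inside B.  The
    translate to add has to contain x and to fit in every C covered by both A
    and B; it is the one at x - a if such a difference with a odd is in B and x
    is 2 modulo 4, and the one at x otherwise. *)
Lemma covers_enlarge A B :
    periodic m A -> periodic m B -> A `<=` B -> ~ covers A B ->
  exists t, [/\ B t, ~ fits A B t & forall C, periodic m C ->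
    covers A C -> covers B C -> covers (B `|` shift t A) C].
Proof.
move=> hA hB AB nAB.
have [x [Bx nBxm xAB]] : exists x, [/\ B x, ~ B (x - m) & ~ covered A B x].
  apply: contrapT => nx; apply: nAB; apply: (covers_first m0 hB) => x Bx nBxm.
  by apply: contrapT => nxAB; apply: nx; exists x.
have nAx : ~ A x.
  by move=> Ax; apply: xAB; exists 0 => [a /AB|]; rewrite ?add0r ?subr0.
have nfx : ~ fits A B x.
  move=> xfits; apply: xAB; exists x => //.
  by rewrite subrr; exact: periodic0 hA.
have [[m4 [x2 [a [Aa a1 Bxa]]]]|nodiff] := pselect (m = 4 /\ (x %% 4)%Z = 2 /\
    exists a, [/\ A a, (a %% 2)%Z = 1 & B (x - a)]).
  have [a0 [Aa0 nAa0 a0a ma0]] := exists_first m0 hA Aa.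
  have Bxa0 : B (x - a0).
    by apply: (periodic_up m0 hB Bxa); move: ma0; rewrite ?m4; lia.
  have a01 : (a0 %% 2)%Z = 1 by move: ma0; rewrite m4; lia.
  exists (x - a0); split=> //.
    by move=> fxa0; apply: xAB; exists (x - a0) => //; rewrite subKr.
  move=> C hC AC BC; have := covers_setU_shift_difference m4 hA hB hC AB AC BC.
  exact.
exists x; split=> // C hC AC BC; apply: covers_setU_shift => //.
have Cx := covers_sub hB hC BC Bx.
have [[m4 x2]|nx2] := pselect (m = 4 /\ (x %% 4)%Z = 2).
  apply: (fits_no_difference m4 hA hB hC AB AC BC Bx nAx) => a Aa a1 Bxa.
  by apply: nodiff; split=> //; split=> //; exists a.
by apply: covers_split_odd => // m4 x2; apply: nx2.
Qed.

End SmallPeriod.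

(** * Normalized ideals *)

Lemma numsg_conductor (S : numSemigroup) :
  exists F : nat, forall n, (F <= n)%N -> numsg_set S n.
Proof.
have /finite_seqP[s sE] := numsg_cofinite S.
exists (\max_(i <- s) i).+1 => n sn; apply: contrapT => nSn.
have : [set` s] n by rewrite -sE.
by move=> /= ns; have := leq_bigmax_seq (F := id) n ns isT; rewrite leqNgt sn.
Qed.

Section NormalizedIdeals.
Context (S : numSemigroup).
Implicit Types I J K : nideal S.

Lemma nideal_exists (P : set int) : P 0 -> lbound P 0 ->
    (forall x s, P x -> numsg_set S s -> P (x + s%:Z)) ->
  exists I : nideal S, I = P :> set int.
Proof.
move=> P0 Pge0 PS; suff iP : is_ideal S P by exists (NIdeal iP (conj P0 Pge0)).
split; first by exists 0.
  apply/seteqP; split=> [_ [x Px [_ [s Ss <-] <-]]|x Px]; first exact: PS.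
  by exists x => //; exists 0; [exists 0%N; [exact: numsg0|]|rewrite addr0].
have [F SF] := numsg_conductor S; exists F%:Z => _ [x /Pge0 x0 <-].
exists (F + `|x|)%N; first by apply: SF; rewrite leq_addr.
by rewrite PoszD gez0_abs.
Qed.

Lemma nideal_ge0 I x : nideal_set I x -> 0 <= x.
Proof. by have [_] := nideal_normalized I; exact. Qed.

Lemma nideal0 I : nideal_set I 0. Proof. by have [] := nideal_normalized I. Qed.

Lemma nideal_add I x s :
  nideal_set I x -> numsg_set S s -> nideal_set I (x + s%:Z).
Proof.
move=> Ix Ss; have [_ <- _] := nideal_ideal I.
by exists x => //; exists s%:Z => //; exists s.
Qed.

Lemma nideal_periodic I n : numsg_set S n -> periodic n%:Z I.
Proof.
move=> Sn; split=> [|x|x Ix]; [exact: nideal0|exact: nideal_ge0|].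
exact: nideal_add.
Qed.

(** From right to left, K is the residual of J by I. *)
Lemma nideal_leP I J : (I <= J)%O <-> covers I J.
Proof.
split=> [/asboolP[K IK] y|IJ].
  rewrite -IK => -[i Ii [k Kk <-]]; exists k; last by rewrite addrK.
  by move=> a Ia; exists a => //; exists k => //; rewrite addrC.
have per := nideal_periodic _ (numsg0 S).
have sub := covers_sub (per I) (per J) IJ.
have [||x s xIJ Ss a /xIJ Jxa|K KE] := @nideal_exists (fits I J).
- by move=> a /sub; rewrite add0r.
- by move=> x /(fits_mem (per I)); exact: nideal_ge0.
- by rewrite addrAC; exact: nideal_add.
apply/asboolP; exists K; rewrite KE; apply/seteqP.
split=> [_ [a Ia [t tIJ <-]]|y].
  by rewrite addrC; exact: tIJ.
by move=> /IJ[t tIJ Iyt]; exists (y - t) => //; exists t => //; rewrite subrK.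
Qed.

Lemma nideal_setU_shift I J t : 0 <= t ->
  exists K, K = I `|` shift t J :> set int.
Proof.
move=> t0; apply: nideal_exists.
- by left; exact: nideal0.
- move=> x [/nideal_ge0 //|[a /nideal_ge0 a0 <-]]; exact: addr_ge0.
- move=> x s [Ix|[a Ja <-]] Ss; first by left; exact: nideal_add.
  by right; exists (a + s%:Z); [exact: nideal_add|rewrite addrA].
Qed.

Lemma nideal_bot : exists K, forall I, (K <= I)%O.
Proof.
exists (NIdeal (numsgZ_ideal S) (numsgZ_normalized S)) => I.
apply/nideal_leP => y Iy; exists y; last by rewrite subrr; exact: nideal0.
by move=> _ [s Ss <-]; exact: nideal_add.
Qed.

Lemma nideal_top : exists K, forall I, (I <= K)%O.
Proof.
have [//|//|x s x0 _|K KE] := @nideal_exists [set x | 0 <= x].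
  by rewrite /= addr_ge0.
exists K => I; apply/nideal_leP; rewrite KE => y /= y0; exists y.
  by move=> a /nideal_ge0 a0; exact: addr_ge0.
by rewrite subrr; exact: nideal0.
Qed.

(** The size counts the elements below the conductor; beyond it all normalized
    ideals agree. *)
Lemma nideal_size : exists (F : nat) (size : nideal S -> nat),
  (forall I, (size I <= F)%N) /\
  (forall I J, I `<=` J -> ~ (J `<=` I) -> (size I < size J)%N).
Proof.
have [F SF] := numsg_conductor S.
exists F, (fun I => \sum_(n < F) `[< nideal_set I n%:Z >])%N.
split=> [I|I J IJ nJI].
  rewrite -[leqRHS]card_ord -sum1_card; apply: leq_sum => n _.
  exact: leq_b1.
have [x [Jx nIx]] : exists x, nideal_set J x /\ ~ nideal_set I x.
  apply: contrapT => nx; apply: nJI => x Jx.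
  by apply: contrapT => nIx; apply: nx; exists x.
have x0 := nideal_ge0 Jx.
have xF : (`|x| < F)%N.
  rewrite ltnNge; apply/negP => /SF Sx; apply: nIx.
  by have := nideal_add (nideal0 I) Sx; rewrite add0r gez0_abs.
rewrite (bigD1 (Ordinal xF)) // [ltnRHS](bigD1 (Ordinal xF)) //=.
rewrite gez0_abs // asboolF // asboolT // add0n add1n ltnS.
apply: leq_sum => n _; case: asboolP => // In; rewrite asboolT //; exact: IJ.
Qed.

Lemma nideal_maximal (P : nideal S -> Prop) : (exists I, P I) ->
  exists2 M, P M & forall J, P J -> M `<=` J -> J `<=` M.
Proof.
have [F [size [sizeF size_lt]]] := nideal_size.
case=> I PI; pose Q n := `[< exists2 J, P J & size J = n >].
have exQ : exists n, Q n by exists (size I); apply/asboolP; exists I.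
have Qle n : Q n -> (n <= F)%N by move=> /asboolP[J _ <-].
have [n /asboolP[M PM <-] nmax] := ex_maxnP exQ Qle.
exists M => // J PJ MJ; apply: contrapT => /(size_lt _ _ MJ); rewrite ltnNge.
by move=> /negP; apply; apply: nmax; apply/asboolP; exists J.
Qed.

Lemma nideal_minimal (P : nideal S -> Prop) : (exists I, P I) ->
  exists2 M, P M & forall J, P J -> J `<=` M -> M `<=` J.
Proof.
have [F [size [sizeF size_lt]]] := nideal_size.
case=> I PI; pose Q n := `[< exists2 J, P J & size J = n >].
have exQ : exists n, Q n by exists (size I); apply/asboolP; exists I.
have [n /asboolP[M PM <-] nmin] := ex_minnP exQ.
exists M => // J PJ JM; apply: contrapT => /(size_lt _ _ JM); rewrite ltnNge.
by move=> /negP; apply; apply: nmin; apply/asboolP; exists J.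
Qed.

(** A common lower bound that is maximal for inclusion is the infimum. *)
Lemma meets_small (m : nat) : numsg_set S m -> m%:Z = 3 \/ m%:Z = 4 ->
  forall I J, infimums [set I; J] !=set0.
Proof.
move=> Sm m34 I J; have [B0 B0min] := nideal_bot.
have per K : periodic m%:Z K := nideal_periodic K Sm.
pose lower K := (K <= I)%O /\ (K <= J)%O.
have [|M [MI MJ] Mmax] := @nideal_maximal lower; first by exists B0.
exists M; split=> [_ [->|->] //|K K_lower].
have [KI KJ] : lower K by split; apply: K_lower; [left|right].
move: KI KJ => /nideal_leP KI /nideal_leP KJ.
move: MI MJ => /nideal_leP MI /nideal_leP MJ.
have maximal (E : nideal S) : covers E I -> covers E J -> M `<=` E -> E `<=` M.
  by move=> EI EJ; apply: Mmax; split; exact/nideal_leP.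
have KM : K `<=` M.
  have [U UE] := nideal_setU_shift M K (lexx 0).
  have s0 : shift 0 K = K.
    by apply/seteqP; split=> [_ [a Ka <-]|a Ka]; [|exists a]; rewrite ?add0r.
  rewrite s0 in UE.
  suff : U `<=` M by rewrite UE; apply: subset_trans; exact: subsetUr.
  have UP P := covers_setU m34 (per M) (per K) (per P).
  by apply: maximal; rewrite UE; [exact: UP|exact: UP|exact: subsetUl].
apply/nideal_leP; apply: contrapT => nKM.
have [t [Mt nfit cov]] := covers_enlarge m34 (per K) (per M) KM nKM.
have [E EE] := nideal_setU_shift M K (nideal_ge0 Mt).
apply: nfit => a Ka; suff : E `<=` M by apply; rewrite EE; right; exists a.
have EP P := cov _ (per P).
by apply: maximal; rewrite EE; [exact: EP|exact: EP|exact: subsetUl].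
Qed.

(** A common upper bound that is minimal for inclusion is the supremum: its
    infimum with any other upper bound is again an upper bound, contained in
    it. *)
Lemma lattice_of_meets :
  (forall I J, infimums [set I; J] !=set0) -> is_lattice (nideal S).
Proof.
move=> meets I J; split=> //; have [T Tmax] := nideal_top.
pose upper K := (I <= K)%O /\ (J <= K)%O.
have [|M [IM JM] Mmin] := @nideal_minimal upper; first by exists T.
exists M; split=> [_ [->|->] //|K K_upper].
have [IK JK] : upper K by split; apply: K_upper; [left|right].
have [L [L_lower L_greatest]] := meets M K.
have LM : (L <= M)%O by apply: L_lower; left.
have LK : (L <= K)%O by apply: L_lower; right.
suff : M `<=` L.
  move=> ML; have -> // : M = L.
  by apply: nideal_inj; apply/seteqP; split=> //; exact: nideal_le_sub LM.
apply: Mmin; last exact: nideal_le_sub.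
by split; apply: L_greatest => _ [->|->].
Qed.

End NormalizedIdeals.

(** * Multiplicity at least five *)

Lemma lattice_multiplicity (S : numSemigroup) :
  is_lattice (nideal S) -> (multiplicity S <= 4)%N.
Proof.
rewrite /multiplicity; case: ex_minnP => m /andP[/asboolP Sm m0] m_min lat.
rewrite leqNgt; apply/negP => m5.
have S_ge s : numsg_set S s -> s = 0%N \/ (m <= s)%N.
  move=> Ss; case: (posnP s) => [|s0]; [by left|right].
  by apply: m_min; rewrite s0 andbT; apply/asboolP.
(* All nonzero elements of S are at least m, so only 0 constrains P below m. *)
have with_tail (P : int -> Prop) : P 0 -> exists I : nideal S,
    I = [set x | 0 <= x /\ (P x \/ m%:Z <= x)] :> set int.
  move=> P0; apply: nideal_exists => [|x []//|x s [x0 Px] /S_ge[->|ms]] /=.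
  - by split=> //; left.
  - by rewrite addr0.
  - by split; [|right]; lia.
have [|A AE] := with_tail (fun x => x <= 1); first lia.
have [|B BE] := with_tail (fun x => x <> m%:Z - 1 /\ x <> m%:Z - 3); first lia.
have [|C CE] := with_tail (fun x => x <> m%:Z - 1); first lia.
have [|D DE] := with_tail (fun x => x <> m%:Z - 3); first lia.
have AC : (A <= C)%O.
  apply/nideal_leP; rewrite AE CE => y /= Cy.
  have [y0|y0] := eqVneq y 0; [exists 0|exists (if y < m%:Z then y - 1 else y)].
  - by move=> x /=; lia.
  - by move=> /=; lia.
  - by move=> x /=; case: ifP; lia.
  - by move=> /=; case: ifP; lia.
have AD : (A <= D)%O.
  apply/nideal_leP; rewrite AE DE => y /= Dy.
  have [y0|y0] := eqVneq y 0; first by exists 0 => [x|] /=; lia.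
  exists (if (y == m%:Z - 2) || (m%:Z <= y) then y else y - 1) => [x|] /=;
    by case: ifP; lia.
have BC : (B <= C)%O.
  apply/nideal_leP; rewrite BE CE => y /= Cy.
  exists (if y == m%:Z - 3 then 2 else 0) => [x|] /=; case: ifP; lia.
have BD : (B <= D)%O.
  apply/nideal_leP; rewrite BE DE => y /= Dy.
  exists (if y == m%:Z - 1 then y else 0) => [x|] /=; case: ifP; lia.
have [_ [L [L_upper L_least]]] := lat A B.
have AL : (A <= L)%O by apply: L_upper; left.
have BL : (B <= L)%O by apply: L_upper; right.
have LC : (L <= C)%O by apply: L_least => _ [->|->].
have LD : (L <= D)%O by apply: L_least => _ [->|->].
have LsC := nideal_le_sub LC; have LsD := nideal_le_sub LD.
(* Every element of L below m lies in B, and the translate of A at m - 2 or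
   m - 3 that covers m - 2 leaves C or D. *)
have Lm2 : nideal_set L (m%:Z - 2).
  by apply: (nideal_le_sub BL); rewrite BE /=; lia.
have /nideal_leP/(_ _ Lm2)[t tAL] := AL; rewrite AE /= => At.
have A0 := tAL 0 (nideal0 A).
have /tAL Lt1 : nideal_set A 1 by rewrite AE /=; lia.
have t0 := nideal_ge0 A0.
have := LsD _ A0; have := LsC _ Lt1; rewrite CE DE /=; lia.
Qed.

(** * The characterization *)

Theorem corollary18 (S : numSemigroup) :
  is_lattice (nideal S) <-> (multiplicity S <= 4)%N.
Proof.
split; first exact: lattice_multiplicity.
rewrite /multiplicity; case: ex_minnP => m /andP[/asboolP Sm m0] _ m4.
apply: lattice_of_meets.
have [m3|m3] := eqVneq m 3.
  by rewrite m3 in Sm; apply: (meets_small Sm); left.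
(* A multiple of the multiplicity serves when the latter is 1 or 2. *)
apply: (@meets_small _ 4); last by right.
have [m1|[m2|m4']] : (m = 1 \/ m = 2 \/ m = 4)%N by lia.
- by have := numsgD (numsgD Sm Sm) (numsgD Sm Sm); rewrite m1.
- by have := numsgD Sm Sm; rewrite m2.
- by rewrite -m4'.
Qed.
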